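(* Let $p,q\in(1,+\infty)$ and let $p'$ be the conjugate exponent of $p$. Then for every real $\alpha>0$ $$(\alpha q+1)^{-1/q}\le \|T_\alpha\|_{p,q}\le \min\Big\{\big(\alpha\tfrac{q}{p'}+1\big)^{-1/q},\ \big[\alpha\, B\big(\tfrac{p'}{q}+1,\alpha\big)\big]^{1/p'}\Big\},$$ where $B(a,b):=\int_0^1 x^{a-1}(1-x)^{b-1}\,dx$ is the Euler Beta function. In particular, for fixed $p,q$, $$\|T_\alpha\|_{p,q}\asymp \alpha^{-1/q}\quad\text{as }\alpha\to\infty,$$ $$\|T_\alpha-T_0\|_{p,q}\asymp \alpha^{1/p'}\quad\text{as }\alpha\to 0,$$ $$\big|\|T_\alpha\|_{p,q}-1\big|\asymp \alpha\quad\text{as }\alpha\to 0.$$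
   Context: For real $\alpha\ge 0$, $T_\alpha\colon L^p[0,1]\to L^q[0,1]$ is the bounded linear operator $(T_\alpha f)(x):=\int_0^{x^\alpha} f(y)\,dy$; for $\alpha=0$ this is $(T_0f)(x)=\int_0^1 f(y)\,dy$. $\|\cdot\|_{p,q}$ denotes the operator norm of operators $L^p[0,1]\to L^q[0,1]$. The conjugate exponent $p'$ satisfies $1/p+1/p'=1$. The notation $f(x)\asymp g(x)$ as $x\to x_0$ means that both $|f(x)/g(x)|$ and $|g(x)/f(x)|$ stay bounded as $x\to x_0$ (here the implied bounds may depend on $p$ and $q$; $\alpha\to 0$ means $\alpha\to0^+$). *)

(* Defs.v *)
From HB Require Import structures.
From mathcomp Require Import all_boot all_order all_algebra.
From mathcomp Require Import all_classical all_reals all_analysis.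
From mathcomp Require Import measurable_realfun.

Set Implicit Arguments.
Unset Strict Implicit.
Unset Printing Implicit Defensive.
Import Order.TTheory GRing.Theory Num.Theory.
Import numFieldNormedType.Exports.
Local Open Scope classical_set_scope.
Local Open Scope ring_scope.

Section lebesgue01.
Context (R : realType).

Lemma lebesgue_itv01_lty :
  (lebesgue_measure (`[0%R, 1%R]%classic : set R) < +oo)%E.
Proof. by rewrite lebesgue_measure_itv/= lte01 oppr0 adde0 ltry. Qed.

(* L^p[0,1] is modelled on functions R -> R with respect to Lebesgue measure
   restricted to [0,1]: the values outside [0,1] are irrelevant. *)
Definition lebesgue01 : {finite_measure set (measurableTypeR R) -> \bar R} :=
  @mfrestr _ (measurableTypeR R) R `[0%R, 1%R]%classic lebesgue_measure
    (measurable_itv `[0%R, 1%R]) lebesgue_itv01_lty.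

End lebesgue01.
Arguments lebesgue01 {R}.

Lemma exponent_ge1 (R : realType) (p : R) : 1 < p -> (1 <= p%:E)%E.
Proof. by rewrite lee_fin => /ltW. Qed.

Section power_integral.
Context (R : realType).
Local Notation mu := (@lebesgue01 R).

(* [0 `^ 0 = 1], so for alpha = 0 the integral is over [0,1] for every x. *)
Definition power_integral (alpha : R) (f : R -> R) (x : R) : R :=
  \int[mu]_(y in `[0, x `^ alpha]) f y.

Let int_sub (f : R -> R) (x : R) : mu.-integrable setT (EFin \o f) ->
  mu.-integrable `[0, x] (EFin \o f).
Proof. by apply: integrableS. Qed.

Let measurable_primitive (f : R -> R) : mu.-integrable setT (EFin \o f) ->
  measurable_fun setT (fun x : R => \int[mu]_(y in `[0, x]) f y).
Proof.
move=> intf.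
have ndec (g : R -> R) : (forall x, 0 <= g x) ->
    mu.-integrable setT (EFin \o g) ->
    measurable_fun setT (fun x : R => \int[mu]_(y in `[0, x]) g y).
  move=> g0 intg; apply: nondecreasing_measurable => // s t st.
  rewrite fine_le//.
  - by apply: integrable_fin_num => //; exact: int_sub.
  - by apply: integrable_fin_num => //; exact: int_sub.
  apply: ge0_subset_integral => //.
  - have /int_sub := intg; move=> /(_ t); exact: measurable_int.
  - by move=> x _; rewrite lee_fin.
  - by apply: subset_itvl; rewrite bnd_simp.
have intp : mu.-integrable setT (EFin \o (fun x : R => `|f x|)).
  exact: integrable_norm.
have h (x : R) : \int[mu]_(y in `[0, x]) f y =
    \int[mu]_(y in `[0, x]) (`|f y| + f y) - \int[mu]_(y in `[0, x]) `|f y|.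
  by rewrite RintegralD//; [rewrite addrAC subrr add0r| exact: int_sub..].
rewrite (_ : (fun x : R => _) =
    (fun x : R => \int[mu]_(y in `[0, x]) (`|f y| + f y)) \-
    (fun x : R => \int[mu]_(y in `[0, x]) `|f y|)); last exact/funext.
apply: measurable_funB; apply: ndec => //.
  by move=> x; rewrite -lerBlDr sub0r -normrN ler_norm.
exact: (integrableD measurableT intp intf).
Qed.

Variables (p q : R) (p1 : (1 <= p%:E)%E) (q1 : (1 <= q%:E)%E).
Local Notation Lp := (LfunType mu p1).
Local Notation Lq := (LfunType mu q1).

Lemma Lfun01_integrable (f : Lp) : mu.-integrable setT (EFin \o f).
Proof.
apply/Lfun1_integrable; apply: (@Lfun_subset _ _ _ mu 1 p%:E) => //.
  exact: fin_num_measure.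
exact: LfunP.
Qed.

Lemma power_integral_Lfun (alpha : R) (f : Lp) :
  power_integral alpha f \in Lfun mu q%:E.
Proof.
have intf := Lfun01_integrable f.
have mT : measurable_fun setT (power_integral alpha f).
  apply: (measurableT_comp (measurable_primitive intf)).
  exact: measurable_powR.
pose C := \int[mu]_x `|f x|.
have TC x : `|power_integral alpha f x| <= C.
  apply: (le_trans (le_normr_Rintegral _ (int_sub _ intf))) => //.
  rewrite fine_le//.
  - by apply: integrable_fin_num => //; apply: int_sub; exact: integrable_norm.
  - by apply: integrable_fin_num => //; exact: integrable_norm.
  apply: ge0_subset_integral => //.
  apply: (measurable_int mu); exact: integrable_norm.
have := Lfun_cst mu C q; rewrite inE => /andP[_].
rewrite inE /finite_norm => CL.
rewrite inE; apply/andP; split; rewrite inE// /= /finite_norm.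
apply: le_lt_trans CL; rewrite unlock.
have q0 : 0 <= q by move: q1; rewrite lee_fin; apply: le_trans.
have C0 : 0 <= C by apply: le_trans (TC 0).
apply: (@gt0_ler_poweR R q^-1).
- by rewrite invr_ge0.
- by rewrite in_itv/= leey integral_ge0// => x _; rewrite poweR_ge0.
- by rewrite in_itv/= leey integral_ge0// => x _; rewrite poweR_ge0.
apply: ge0_le_integral => //=.
- apply/measurable_EFinP.
  apply: (@measurableT_comp _ _ _ _ _ _ (@powR R ^~ q)) => //.
  exact: measurableT_comp.
- by move=> x _; rewrite lee_fin ge0_ler_powR// ?nnegrE// (ger0_norm C0).
Qed.

Definition power_op (alpha : R) (f : Lp) : Lq :=
  Lfun_Sub q1 (power_integral_Lfun alpha f).

Lemma power_op_linear (alpha : R) : linear (power_op alpha).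
Proof.
move=> a f g; apply/LfuneqP => x /=.
rewrite /power_integral.
have intf := int_sub (x `^ alpha) (Lfun01_integrable f).
have intg := int_sub (x `^ alpha) (Lfun01_integrable g).
transitivity (\int[mu]_(y in `[0, x `^ alpha]) (a * f y + g y)) => //.
have iaf : mu.-integrable `[0, x `^ alpha] (EFin \o (fun y : R => a * f y)).
  have := @integrableZl _ _ _ mu `[0, x `^ alpha] (measurable_itv _) a
    (EFin \o f) intf.
  exact.
rewrite (RintegralD _ iaf intg)// RintegralZl//.
Qed.

HB.instance Definition _ (alpha : R) :=
  GRing.isLinear.Build R Lp Lq _ (power_op alpha) (power_op_linear alpha).

(* [LfunType] does not identify a.e. equal functions; the supremum over the
   unit ball is the same as over classes, 'N_p being constant on them. *)
Definition opnorm (T : {linear Lp -> Lq}) : \bar R :=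
  ereal_sup [set 'N[mu]_q%:E[EFin \o T f]%E
            | f in [set f : Lp | ('N[mu]_p%:E[EFin \o f] <= 1)%E]].

End power_integral.
Arguments power_op {R p q} p1 q1 alpha f.

Definition euler_beta {R : realType} (a b : R) : R :=
  \int[lebesgue_measure]_(x in `[0, 1]) (x `^ (a - 1) * (1 - x) `^ (b - 1)).

(* Since [y / 0 = 0], the quotients are also required to be meaningful. *)
Definition asymp {R : realType} (F : set_system R) (f g : R -> R) : Prop :=
  [/\ \forall x \near F, f x != 0 /\ g x != 0,
      bounded_near (fun x => f x / g x) F &
      bounded_near (fun x => g x / f x) F].

(* Main.v *)
From HB Require Import structures.
Require Import Defs.
From mathcomp Require Import all_boot all_order all_algebra.
From mathcomp Require Import all_classical all_reals all_analysis.
From mathcomp Require Import measurable_realfun.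
From mathcomp Require Import ring lra.

Set Implicit Arguments.
Unset Strict Implicit.
Unset Printing Implicit Defensive.
Import Order.TTheory GRing.Theory Num.Theory.
Import numFieldNormedType.Exports.
Local Open Scope classical_set_scope.
Local Open Scope ring_scope.

(** The kernel of the operator of exponent a is the indicator of the region
    0 <= y <= x ^ a of the unit square, and the two upper bounds come from slicing
    this region in its two directions.

    Slicing at fixed x, Hoelder's inequality on [0, x ^ a] gives the pointwise
    bound |T f (x)| <= x ^ (a/p') for f in the unit ball, whose L^q norm is
    (a q/p' + 1) ^ (-1/q) ([opnorm_power_op_le]). Slicing at fixed y, Minkowski's
    integral inequality ([minkowski_integral_section]) bounds the L^q norm of T f
    by the integral of |f(y)| (1 - y ^ (1/a)) ^ (1/q), and Hoelder's inequality
    leaves the p'-th root of the integral of (1 - y ^ (1/a)) ^ (p'/q), which the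
    substitution y = u ^ a turns into a Beta integral
    ([integral_onem_powR_beta], [opnorm_power_op_le_beta]). The lower bound is the
    value at the constant function 1 ([le_opnorm_power_op]).

    Of the three asymptotic statements, the one at infinity is read off these
    bounds, as (a c + 1) ^ (-1/q) is comparable with a ^ (-1/q) for each fixed
    c > 0. So is the one about |norm - 1|: the lower bound is at least 1 - a and
    the first upper bound is at most 1 - c a for small a. For the difference with
    the operator of exponent 0, the value at x is, up to sign, the integral of f
    over ]x ^ a, 1], so that Hoelder's inequality bounds it by (1 - x ^ a) ^ (1/p');
    since 1 - x ^ a is O(a) times an arbitrarily small negative power of x, its
    L^q norm is O(a ^ (1/p')) ([opnorm_power_opB_le]). Conversely the normalized
    indicator of ]1 - a, 1] is annihilated by the operator of exponent a at all
    x below a fixed positive threshold, where the operator of exponent 0 gives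
    a ^ (1/p') ([le_opnorm_power_opB]). *)

(** * Integration over the unit interval *)

Section lebesgue01_integral.
Context {R : realType}.
Local Notation mu := (@lebesgue01 R).
Local Notation leb := (@lebesgue_measure R).

Lemma lebesgue01E (A : set R) : mu A = leb (A `&` `[0, 1]).
Proof. by []. Qed.

Lemma lebesgue01_itv0 (y : R) : 0 <= y <= 1 -> mu `[0, y]%classic = y%:E.
Proof.
move=> /andP[y0 y1]; rewrite lebesgue01E (_ : _ `&` _ = `[0, y]%classic).
  rewrite lebesgue_measure_itv/= lte_fin oppr0 adde0.
  by case: ltgtP y0 => // <-.
by apply/setIidPl; apply: subset_itvl; rewrite bnd_simp.
Qed.

Lemma lebesgue01_itv1 (b : bool) (y : R) : 0 <= y <= 1 ->
  mu [set` Interval (BSide b y) (BRight 1)] = (1 - y)%:E.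
Proof.
move=> /andP[y0 y1]; rewrite lebesgue01E.
rewrite (_ : _ `&` _ = [set` Interval (BSide b y) (BRight 1)]).
  rewrite lebesgue_measure_itv/= lte_fin -EFinB.
  by case: ltgtP y1 => // <-; rewrite subrr.
apply/setIidPl; apply: subset_itvr.
by case: b; rewrite bnd_simp.
Qed.

Lemma lebesgue01_setT : mu setT = 1%E.
Proof.
by rewrite lebesgue01E setTI lebesgue_measure_itv/= lte01 oppr0 adde0.
Qed.

Lemma lebesgue01_setC : mu (~` `]0%R, 1%R]%classic) = 0%E.
Proof.
rewrite lebesgue01E (_ : _ `&` _ = [set 0]) ?lebesgue_measure_set1//.
apply/seteqP; split => x /=; rewrite !in_itv/=.
  by case=> /negP; rewrite negb_and -leNgt => /orP[x0|/negbTE->];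
    [move=> /andP[x0' _]; apply/eqP; rewrite eq_le x0 x0'|rewrite andbF].
by move=> ->; rewrite ltxx lexx ler01.
Qed.

(** The left endpoint is dropped because the powers integrated below are
    regular on the half-open interval only. *)
Lemma ge0_integral_lebesgue01 (f : R -> \bar R) :
  measurable_fun setT f -> (forall x, (0 <= f x)%E) ->
  (\int[mu]_x f x = \int[leb]_(x in `]0%R, 1%R]) f x)%E.
Proof.
move=> mf f0.
rewrite (@ge0_negligible_integral _ _ _ mu setT (~` `]0, 1]%classic) f)//;
  [|exact/measurableC|exact: lebesgue01_setC].
rewrite setTD setCK; apply: eq_measure_integral => A mA A01.
rewrite -[LHS]/(leb (A `&` `[0, 1]%classic)); congr (leb _).
apply/setIidPl => x /A01.
by rewrite /= !in_itv/= => /andP[/ltW -> ->].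
Qed.

Lemma ge0_integral_lebesgue01_cc (f : R -> \bar R) :
  measurable_fun setT f -> (forall x, (0 <= f x)%E) ->
  (\int[mu]_x f x = \int[leb]_(x in `[0%R, 1%R]) f x)%E.
Proof.
move=> mf f0; rewrite ge0_integral_lebesgue01// integral_itv_obnd_cbnd//.
exact: measurable_funTS.
Qed.

Lemma le_integral_lebesgue01 (f g : R -> \bar R) :
  measurable_fun setT f -> (forall x, (0 <= f x)%E) ->
  measurable_fun setT g -> (forall x, (0 <= g x)%E) ->
  (forall x, 0 < x <= 1 -> (f x <= g x)%E) ->
  (\int[mu]_x f x <= \int[mu]_x g x)%E.
Proof.
move=> mf f0 mg g0 fg; rewrite !ge0_integral_lebesgue01//.
apply: ge0_le_integral => //; exact: measurable_funTS.
Qed.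

Lemma cvg_integral_lebesgue01 (e : nat -> R) (f : R -> \bar R) :
  measurable_fun setT f -> (forall x, (0 <= f x)%E) ->
  (forall n, 0 < e n) -> nonincreasing_seq e -> e @ \oo --> 0 ->
  (\int[leb]_(x in `[e n, 1%R]) f x @[n --> \oo] --> \int[mu]_x f x)%E.
Proof.
move=> mf f0 e0 ne ce; rewrite ge0_integral_lebesgue01//.
rewrite (_ : `]0, 1]%classic = \bigcup_n `[e n, 1]%classic).
  apply: ge0_nondecreasing_set_cvg_integral => //.
    move=> m n mn; rewrite subsetEset; apply: subset_itvr.
    by rewrite bnd_simp; exact: ne.
  by move=> i; exact: measurable_funTS.
apply/seteqP; split => x /=.
  rewrite in_itv/= => /andP[x0 x1].
  have [N _ /(_ N (leqnn N)) eN] : \forall n \near \oo, e n < x.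
    exact: (cvgr_lt _ ce).
  by exists N => //=; rewrite in_itv/= x1 ltW.
by move=> [n _] /=; rewrite !in_itv/= => /andP[ex ->]; rewrite andbT (lt_le_trans _ ex).
Qed.

(** Reflection maps half-open intervals to half-open intervals of the same length,
    hence preserves Lebesgue measure by uniqueness of the latter. *)
Lemma integral_reflection01 (f : R -> \bar R) :
  measurable_fun setT f -> (forall x, (0 <= f x)%E) ->
  (\int[mu]_x f (1 - x)%R = \int[mu]_x f x)%E.
Proof.
move=> mf f0.
have mr : measurable_fun [set: R] (fun x : R => 1 - x) by exact: measurable_funB.
have mfr := measurableT_comp mf mr.
rewrite !ge0_integral_lebesgue01_cc//.
pose r : measurableTypeR R -> measurableTypeR R := fun x : R => 1 - x.
have rE : `[0, 1]%classic = r @^-1` `[0, 1]%classic.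
  by apply/seteqP; split => x /=; rewrite /r !in_itv/= => /andP[? ?];
    apply/andP; split; lra.
rewrite [in LHS]rE -(@ge0_integral_pushforward _ _ _ _ _ r mr leb _ f)//; last first.
  exact: measurable_funTS.
apply: eq_measure_integral => A mA _.
have mr' : measurable_fun setT r := mr.
pose r' : {mfun measurableTypeR R >-> measurableTypeR R} :=
  HB.pack r (isMeasurableFun.Build _ _ _ _ _ mr').
apply/esym; apply: (@lebesgue_measure_unique R (pushforward leb r')) => //.
move=> _ [[a b]] _ <-.
transitivity (leb `[1 - b, 1 - a[%classic).
  rewrite !lebesgue_measure_itv/= !lte_fin ltrD2l ltrN2.
  by case: ifP => // _; rewrite -!EFinB; congr EFin; ring.
congr (leb _); apply/seteqP; split => x /=; rewrite /r !in_itv/= => /andP[? ?];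
  by apply/andP; split; lra.
Qed.

End lebesgue01_integral.

(** * Substitution of powers *)

Section power_substitution.
Context {R : realType}.
Local Notation mu := (@lebesgue01 R).
Local Notation leb := (@lebesgue_measure R).
Implicit Types a b c s x y u : R.

Lemma continuous_powR a x : 0 < x -> {for x, continuous (fun u : R => u `^ a)}.
Proof.
move=> x0; apply/differentiable_continuous/derivable1_diffP.
by apply: derivable_powR; rewrite in_itv/= x0.
Qed.

(** The absolute value avoids the jump of [powR] at 0 from the left. *)
Lemma continuous_norm_powR s : 0 < s -> continuous (fun z : R => `|z| `^ s).
Proof.
move=> s0 z; have [->|z0] := eqVneq z 0; last first.
  apply: (@continuous_comp _ _ _ (fun u : R => `|u|) (fun u : R => u `^ s)).
    exact: norm_continuous.
  by apply: continuous_powR; rewrite normr_gt0.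
rewrite /continuous_at normr0 powR0 ?gt_eqF//.
apply/cvgrPdist_lt => e e0; near=> t.
rewrite sub0r normrN ger0_norm ?powR_ge0//.
rewrite -[ltRHS](@powRr1 R) ?(ltW e0)// -(mulVf (lt0r_neq0 s0)) powRrM.
rewrite gt0_ltr_powR ?nnegrE ?powR_ge0//.
near: t; apply: cvgr0_norm_lt; last exact: powR_gt0.
exact: cvg_id.
Unshelve. all: by end_near. Qed.

Lemma continuous_derive1_powR a x : 0 < x ->
  {for x, continuous ((fun u : R => u `^ a)^`()%classic)}.
Proof.
move=> x0.
have E : forall y, 0 < y -> ((fun u : R => u `^ a)^`()%classic) y = a * y `^ (a - 1).
  by move=> y y0; rewrite powR_derive1// in_itv/= y0.
rewrite /prop_for /continuous_at E//.
have c : (a * u `^ (a - 1)) @[u --> x] --> a * x `^ (a - 1).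
  by apply: cvgM; [exact: cvg_cst|exact: continuous_powR].
apply: cvg_trans c; apply: near_eq_cvg; near=> u.
apply/esym/E; near: u; exact: lt_nbhsr.
Unshelve. all: by end_near. Qed.

(** On [e, 1] with e > 0 this is the substitution y = u ^ a of a smooth
    function; both sides then exhaust the unit interval as e tends to 0, so that
    the possible singularity of the density at 0 is harmless. *)
Lemma integral_power_substitution a (H : R -> R) : 0 < a ->
  measurable_fun setT H -> (forall x, 0 <= H x) ->
  (forall x, 0 < x -> {for x, continuous H}) ->
  (\int[mu]_y (H y)%:E = \int[mu]_u (H (u `^ a) * (a * u `^ (a - 1)))%:E)%E.
Proof.
move=> a0 mH H0 cH.
pose F u := u `^ a.
pose e n : R := n.+1%:R^-1.
have onV : e @ \oo --> (0 : R) by exact: cvg_harmonic.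
have inve : nonincreasing_seq e.
  by move=> m n mn; rewrite lef_pV2 ?posrE// ler_nat.
have e01 n : 0 < e n <= 1.
  by rewrite /e invr_gt0 ltr0n /= invf_le1// ler1n.
have e0 n : 0 < e n by case/andP: (e01 n).
have L : (\int[leb]_(y in `[(e n `^ a)%R, 1%R]) (H y)%:E @[n --> \oo]
    --> \int[mu]_y (H y)%:E)%E.
  apply: (@cvg_integral_lebesgue01 _ (fun n : nat => e n `^ a)
      (fun y => (H y)%:E)).
  - exact/measurable_EFinP.
  - by move=> x; rewrite lee_fin.
  - by move=> n; rewrite powR_gt0// e0.
  - by move=> m n mn; apply: ge0_ler_powR; rewrite ?nnegrE ?inve// ltW.
  - have /(_ 0) := continuous_norm_powR a0.
    rewrite /continuous_at normr0 powR0 ?gt_eqF// => c.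
    have := cvg_comp _ _ onV c.
    by apply: cvg_trans; apply: near_eq_cvg; near=> n; rewrite /= ger0_norm// ltW.
have mG : measurable_fun setT (fun u => H (u `^ a) * (a * u `^ (a - 1))).
  apply: measurable_funM; first exact: (measurableT_comp mH (measurable_powR a)).
  by apply: measurable_funM => //; exact: measurable_powR.
have Rl : (\int[leb]_(u in `[e n, 1%R])
     (H (u `^ a) * (a * u `^ (a - 1)))%:E @[n --> \oo]
    --> \int[mu]_u (H (u `^ a) * (a * u `^ (a - 1)))%:E)%E.
  apply: (@cvg_integral_lebesgue01 _ e
      (fun u => (H (u `^ a) * (a * u `^ (a - 1)))%:E)) => //.
  - exact/measurable_EFinP.
  - by move=> u; rewrite lee_fin !mulr_ge0// ?powR_ge0// ltW.
suff HE n : (\int[leb]_(y in `[(e n `^ a)%R, 1%R]) (H y)%:E =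
    \int[leb]_(u in `[e n, 1%R]) (H (u `^ a) * (a * u `^ (a - 1)))%:E)%E.
  move: L; under eq_fun do rewrite HE; move=> L.
  exact: (cvg_unique _ L Rl).
have /andP[en en1] := e01 n; 
have -> : `[e n `^ a, 1%R]%classic = `[F (e n), F 1]%classic by rewrite /F powR1.
rewrite (@integration_by_substitution_increasing _ F).
- apply: eq_integral => u; rewrite inE/= in_itv/= => /andP[eu _].
  rewrite !fctE powR_derive1 ?in_itv//= andbT.
  exact: lt_le_trans eu.
- exact: en1.
- move=> x y; rewrite !in_itv/= => /andP[ex _] /andP[ey _] xy.
  by apply: gt0_ltr_powR; rewrite ?nnegrE// ltW// (lt_le_trans en).
- move=> x; rewrite in_itv/= => /andP[ex _].
  by apply: continuous_derive1_powR; exact: lt_trans ex.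
- apply/cvg_ex; exists (F^`()%classic (e n)); apply: cvg_at_right_filter.
  exact: continuous_derive1_powR.
- apply/cvg_ex; exists (F^`()%classic 1); apply: cvg_at_left_filter.
  exact: continuous_derive1_powR.
- split.
  + move=> x; rewrite in_itv/= => /andP[ex _].
    by apply: derivable_powR; rewrite in_itv/= (lt_trans en).
  + by apply: cvg_at_right_filter; exact: continuous_powR.
  + by apply: cvg_at_left_filter; exact: continuous_powR.
- apply: continuous_in_subspaceT => x; rewrite inE/= in_itv/= => /andP[ex _].
  by apply: cH; apply: lt_le_trans ex; exact: powR_gt0.
Unshelve. all: by end_near. Qed.

(** The case of a constant integrand in the substitution. *)
Lemma integral_power c : -1 < c ->
  (\int[mu]_x (x `^ c)%:E = ((c + 1)^-1)%:E)%E.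
Proof.
move=> c1; have c10 : 0 < c + 1 by lra.
have E : (\int[mu]_x (1 * ((c + 1) * x `^ (c + 1 - 1)))%:E = 1)%E.
  rewrite -(@integral_power_substitution (c + 1) (cst 1))//=.
    by rewrite integral_cst// mul1e; exact: lebesgue01_setT.
  by move=> x x0; exact: cst_continuous.
under eq_integral.
  move=> x _; rewrite (_ : x `^ c = (c + 1)^-1 * (1 * ((c + 1) * x `^ (c + 1 - 1)))).
    by rewrite EFinM; over.
  by rewrite mul1r mulKf ?gt_eqF// addrK.
rewrite ge0_integralZl//=.
- by rewrite E mule1.
- by apply/measurable_EFinP; do 2 apply: measurable_funM => //; exact: measurable_powR.
- by move=> x _; rewrite lee_fin !mulr_ge0 ?powR_ge0// ltW.
- by rewrite lee_fin invr_ge0 ltW.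
Qed.

End power_substitution.

(** * Hoelder's and Minkowski's inequalities on sections *)

Section hoelder_minkowski.
Local Open Scope ereal_scope.

Lemma hoelder_indic d (T : measurableType d) (R : realType)
    (m : {measure set T -> \bar R}) (p p' : R) (f : T -> R) (A : set T) :
  (0 < p)%R -> (0 < p')%R -> (p^-1 + p'^-1 = 1)%R ->
  measurable_fun setT f -> measurable A ->
  \int[m]_(x in A) `|f x|%:E <= 'N[m]_p%:E[EFin \o f] * m A `^ p'^-1.
Proof.
move=> p0 p'0 pp' mf mA.
have := hoelder m mf (measurable_indic mA) p0 p'0 pp'.
rewrite Lnorm1 [in X in _ <= _ * X]unlock.
rewrite (_ : \int[m]_x `|(EFin \o (\1_A : T -> R)) x| `^ p' = m A); last first.
  transitivity (\int[m]_x (\1_A x)%:E); last by rewrite integral_indic// setIT.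
  apply: eq_integral => x _ /=; rewrite indicE.
  by case: (x \in A); rewrite ?mulr1n ?mulr0n ?normr1 ?normr0 ?powR1// powR0// gt_eqF.
apply: le_trans; rewrite integral_mkcond le_eqVlt; apply/orP; left; apply/eqP.
apply: eq_integral => x _ /=; rewrite patchE indicE.
by case: (x \in A); rewrite ?mulr1 ?mulr0 ?normr0.
Qed.

(** The last step of the usual proofs of Minkowski-type inequalities; finiteness
    of J is what allows the division. *)
Lemma poweR_cancel (R : realType) (q : R) (J K : \bar R) : (0 < q)%R ->
  0 <= J -> J \is a fin_num -> 0 <= K -> J <= J `^ (1 - q^-1) * K ->
  J `^ q^-1 <= K.
Proof.
move=> q0; case: J => // j j0 _ K0.
have [->|jn0] := eqVneq j 0%R.
  have qn0 : (q^-1 != 0)%R by rewrite gt_eqF// invr_gt0.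
  by rewrite (poweR0r qn0).
have {jn0}j0' : (0 < j)%R by rewrite lt_neqAle eq_sym jn0.
case: K K0 => [k k0||]//; last by move=> *; rewrite leey.
rewrite !poweR_EFin -EFinM !lee_fin.
rewrite powRB; last by rewrite (gt_eqF j0') implybT.
rewrite powRr1; last exact: ltW.
by rewrite mulrAC ler_pdivlMr ?powR_gt0// ler_pM2l.
Qed.

(** Write F for the inner integral and J for the integral of F ^ q.
    Then F ^ q = F ^ (q - 1) * F, so exchanging the integrations and
    applying Hoelder's inequality to F ^ (q - 1) on each section bounds J by
    J ^ (1 - 1/q) times the right-hand side. As J is finite, it cancels. *)
Lemma minkowski_integral_section d1 d2 (X : measurableType d1)
    (Y : measurableType d2) (R : realType)
    (m1 : {finite_measure set X -> \bar R}) (m2 : {finite_measure set Y -> \bar R})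
    (q : R) (E : set (X * Y)) (g : Y -> R) :
  (1 < q)%R -> measurable E -> (forall y, 0 <= g y)%R ->
  m2.-integrable setT (EFin \o g) ->
  (\int[m1]_x (\int[m2]_(y in xsection E x) (g y)%:E) `^ q) `^ q^-1 <=
  \int[m2]_y ((g y)%:E * m1 (ysection E y) `^ q^-1).
Proof.
move=> q1 mE g0 intg.
have q0 : (0 < q)%R by exact: lt_trans q1.
have mg : measurable_fun setT g by exact/measurable_EFinP/(measurable_int m2).
pose F x := \int[m2]_(y in xsection E x) (g y)%:E.
pose C := \int[m2]_y (g y)%:E.
have Cfin : C \is a fin_num by exact: integrable_fin_num.
have F0 x : 0 <= F x by apply: integral_ge0 => y _; rewrite lee_fin.
have FC x : F x <= C.
  apply: ge0_subset_integral => //; first exact: measurable_xsection.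
    exact/measurable_EFinP.
  by move=> y _; rewrite lee_fin.
have Ffin x : F x \is a fin_num.
  by rewrite ge0_fin_numE// (le_lt_trans (FC x))// -ge0_fin_numE// (le_trans (F0 x)).
pose Fr x := fine (F x).
have FrE x : (Fr x)%:E = F x by rewrite fineK.
have Fr0 x : (0 <= Fr x)%R by exact: fine_ge0.
have mh : measurable_fun setT (fun z : X * Y => (g z.2 * \1_E z)%:E).
  apply/measurable_EFinP/measurable_funM; last exact: measurable_indic.
  exact: measurableT_comp.
have h0 (z : X * Y) : 0 <= (g z.2 * \1_E z)%:E by rewrite lee_fin mulr_ge0.
have FE x : F x = \int[m2]_y (g y * \1_E (x, y))%:E.
  rewrite /F integral_mkcond; apply: eq_integral => y _.
  rewrite patchE indicE mem_xsection.
  by case: (_ \in E); rewrite ?mulr1 ?mulr0.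
have mF : measurable_fun setT F.
  rewrite (_ : F = fubini_F m2 (fun z : X * Y => (g z.2 * \1_E z)%:E)).
    exact: measurable_fun_fubini_tonelli_F.
  by apply/funext => x; rewrite FE.
have mFr : measurable_fun setT Fr by exact: measurableT_comp mF.
have mFrp r : measurable_fun setT (fun x => Fr x `^ r)%R.
  exact: (measurableT_comp (measurable_powR r) mFr).
pose J := \int[m1]_x (Fr x `^ q)%:E.
pose K := \int[m2]_y ((g y)%:E * m1 (ysection E y) `^ q^-1).
have JE : \int[m1]_x (F x) `^ q = J.
  by apply: eq_integral => x _; rewrite -FrE poweR_EFin.
have J0 : 0 <= J by apply: integral_ge0 => x _; rewrite lee_fin powR_ge0.
have K0 : 0 <= K.
  by apply: integral_ge0 => y _; rewrite mule_ge0 ?lee_fin ?poweR_ge0.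
have Jfin : J \is a fin_num.
  rewrite ge0_fin_numE//.
  apply: (@le_lt_trans _ _ (\int[m1]_x (fine C `^ q)%:E)).
    apply: ge0_le_integral.
    - exact: measurableT.
    - by move=> x _; rewrite lee_fin powR_ge0.
    - exact/measurable_EFinP.
    - exact: measurable_cst.
    - move=> x _; rewrite lee_fin; apply: ge0_ler_powR; rewrite ?nnegrE//.
      + exact: ltW.
      + by apply: fine_ge0; exact: le_trans (FC x).
      + by rewrite fine_le.
  by rewrite integral_cst// lte_mul_pinfty ?lee_fin ?powR_ge0 ?ltry//
    fin_num_fun_lty// fin_num_measure.
have conj : ((q / (q - 1))^-1 + q^-1 = 1)%R by field; lra.
have q'0 : (0 < q / (q - 1))%R by rewrite divr_gt0// subr_gt0.
pose h2 (z : X * Y) := (Fr z.1 `^ (q - 1) * (g z.2 * \1_E z))%:E.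
have h20 z : 0 <= h2 z by rewrite lee_fin !mulr_ge0 ?powR_ge0.
have mh2 : measurable_fun setT h2.
  apply/measurable_EFinP/measurable_funM.
    exact: (measurableT_comp (mFrp _) measurable_fst).
  exact/measurable_EFinP.
have JF : J = \int[m1]_x \int[m2]_y h2 (x, y).
  apply: eq_integral => x _; rewrite /h2 /=; under eq_integral do rewrite EFinM.
  rewrite ge0_integralZl//=.
  - by rewrite -FE -FrE -EFinM mulrC mulr_powRB1.
  - exact: measurableT_comp mh (measurable_pair1 _).
  - by move=> y _; exact: (h0 (x, y)).
  - by rewrite lee_fin powR_ge0.
have JK : J <= J `^ (1 - q^-1) * K.
  rewrite [leLHS]JF (fubini_tonelli h2)//.
  have mE1 : measurable_fun setT (fun y => m1 (ysection E y)).
    exact: measurable_fun_ysection.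
  have mK : measurable_fun setT (fun y => (g y)%:E * m1 (ysection E y) `^ q^-1).
    apply: emeasurable_funM; first exact/measurable_EFinP.
    exact: (measurableT_comp (measurable_poweR _) mE1).
  rewrite -ge0_integralZl//; last 2 first.
  - by move=> y _; rewrite mule_ge0 ?lee_fin ?poweR_ge0.
  - exact: poweR_ge0.
  apply: ge0_le_integral => //.
  - by move=> y _; apply: integral_ge0.
  - exact: measurable_fun_fubini_tonelli_G.
  - exact: emeasurable_funM.
  move=> y _ /=.
  rewrite muleCA.
  have -> : \int[m1]_x h2 (x, y) =
      (g y)%:E * \int[m1]_(x in ysection E y) `|Fr x `^ (q - 1)|%:E.
    rewrite [in RHS]integral_mkcond -ge0_integralZl//.
    - apply: eq_integral => x _; rewrite patchE /h2 /= indicE mem_ysection.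
      case: (_ \in E); rewrite ?mulr0 ?mule0// mulr1 -EFinM mulrC.
      by rewrite ger0_norm// powR_ge0.
    - apply/measurable_restrict => //; first exact: measurable_ysection.
      apply: measurable_funTS; apply/measurable_EFinP.
      exact: measurableT_comp.
    - by move=> x _; rewrite patchE; case: ifP; rewrite // lee_fin.
    - by rewrite lee_fin.
  apply: lee_wpmul2l; first by rewrite lee_fin.
  have := hoelder_indic m1 q'0 q0 conj (mFrp (q - 1)%R) (measurable_ysection y mE).
  rewrite Lnorm.unlock.
  rewrite (_ : (q / (q - 1))^-1 = 1 - q^-1)%R; last first.
    by apply/eqP; rewrite eq_sym subr_eq conj.
  rewrite (_ : \int[m1]_x `|_| `^ _ = J); first exact: id.
  apply: eq_integral => x _ /=; rewrite ger0_norm ?powR_ge0// -powRrM.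
  by rewrite mulrCA divff ?mulr1// subr_eq0 gt_eqF.
rewrite -/F JE; exact: poweR_cancel.
Qed.

End hoelder_minkowski.

(** * Upper bounds on operator norms *)

Section upper_bounds.
Context {R : realType}.
Local Notation mu := (@lebesgue01 R).
Implicit Types (p q a x y : R).

Lemma ge0_le_poweR (r : R) (x y : \bar R) : 0 <= r -> (0 <= x)%E -> (x <= y)%E ->
  (x `^ r <= y `^ r)%E.
Proof.
move=> r0 x0 xy; apply: gt0_ler_poweR => //; rewrite in_itv/= leey andbT//.
exact: le_trans xy.
Qed.

Lemma Lnorm_le_lebesgue01 q (g k : R -> R) : 0 < q ->
  measurable_fun setT g -> measurable_fun setT k -> (forall x, 0 <= k x) ->
  (forall x, 0 < x <= 1 -> `|g x| <= k x) ->
  ('N[mu]_q%:E[EFin \o g] <= (\int[mu]_x (k x `^ q)%:E) `^ q^-1)%E.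
Proof.
move=> q0 mg mk k0 gk; rewrite Lnorm.unlock.
apply: ge0_le_poweR; first by rewrite invr_ge0 ltW.
  by apply: integral_ge0 => x _; exact: poweR_ge0.
apply: le_integral_lebesgue01.
- apply/measurable_EFinP.
  apply: (@measurableT_comp _ _ _ _ _ _ (@powR R ^~ q)) => //.
  exact: measurableT_comp.
- by move=> x; exact: poweR_ge0.
- apply/measurable_EFinP.
  exact: (@measurableT_comp _ _ _ _ _ _ (@powR R ^~ q)).
- by move=> x; rewrite lee_fin powR_ge0.
- move=> x x01; rewrite lee_fin ge0_ler_powR ?nnegrE//; first exact: ltW.
  exact: gk.
Qed.

Lemma conj_exponent_gt0 p (p' : R) : 1 < p -> p^-1 + p'^-1 = 1 -> 0 < p'.
Proof.
move=> p1 pp'; have p0 : 0 < p by exact: lt_trans p1.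
rewrite -invr_gt0 (_ : p'^-1 = 1 - p^-1); last by rewrite -pp' addrAC subrr add0r.
by rewrite subr_gt0 invf_lt1.
Qed.

Lemma powR_itv01 a x : 0 <= a -> 0 <= x <= 1 -> 0 <= x `^ a <= 1.
Proof.
move=> a0 /andP[x0 x1]; rewrite powR_ge0/=.
have <- : 1 `^ a = 1 :> R by rewrite powR1.
by apply: ge0_ler_powR; rewrite ?nnegrE.
Qed.

(** The substitution y = u ^ a and the reflection of the unit interval turn the
    left-hand side into the Euler integral; it is at most 1, hence finite. *)
Lemma integral_onem_powR_beta a r : 0 < a -> 0 < r ->
  (\int[mu]_y (`|1 - y `^ a^-1| `^ r)%:E = (a * euler_beta (r + 1) a)%:E)%E.
Proof.
move=> a0 r0; pose H y := `|1 - y `^ a^-1| `^ r.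
have mH : measurable_fun setT H.
  apply: (measurableT_comp (measurable_powR r)); apply: measurableT_comp => //.
  by apply: measurable_funB => //; exact: measurable_powR.
pose B x := x `^ r * (1 - x) `^ (a - 1).
have mB : measurable_fun setT B.
  apply: measurable_funM; first exact: measurable_powR.
  apply: (measurableT_comp (measurable_powR _)).
  by apply: measurable_funB.
have B0 x : 0 <= B x by rewrite mulr_ge0 ?powR_ge0.
have HB : (\int[mu]_y (H y)%:E = a%:E * \int[mu]_x (B x)%:E)%E.
  rewrite (integral_power_substitution a0) //; last 2 first.
  - by move=> x; exact: powR_ge0.
  - move=> x x0.
    apply: (@continuous_comp _ _ _ (fun y : R => 1 - y `^ a^-1)
      (fun z : R => `|z| `^ r)); last exact: continuous_norm_powR.
    by apply: cvgB; [exact: cvg_cst|exact: continuous_powR].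
  rewrite -(@integral_reflection01 _ (EFin \o B))//; last exact/measurable_EFinP.
  have mr : measurable_fun setT (fun x => B (1 - x)).
    by apply: (measurableT_comp mB); exact: measurable_funB.
  rewrite -(@ge0_integralZl _ _ _ mu _ measurableT (fun x => (B (1 - x))%:E));
    last 3 first.
  - exact/measurable_EFinP.
  - by move=> x _; rewrite lee_fin.
  - by rewrite lee_fin ltW.
  have mL : measurable_fun setT (fun u => H (u `^ a) * (a * u `^ (a - 1))).
    apply: measurable_funM; first exact: (measurableT_comp mH (measurable_powR a)).
    by apply: measurable_funM => //; exact: measurable_powR.
  rewrite !ge0_integral_lebesgue01; last 4 first.
  - exact/measurable_EFinP/measurable_funM.
  - by move=> x; rewrite -EFinM lee_fin mulr_ge0// ltW.
  - exact/measurable_EFinP.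
  - by move=> x; rewrite lee_fin !mulr_ge0 ?powR_ge0// ltW.
  apply: eq_integral => u; rewrite inE/= in_itv/= => /andP[u0 u1].
  rewrite -EFinM; congr EFin; rewrite /H /B -powRrM divff ?gt_eqF//.
  rewrite powRr1 ?ltW// ger0_norm ?subr_ge0// subKr.
  by rewrite mulrCA.
have H1 : (\int[mu]_y (H y)%:E <= 1)%E.
  rewrite -[leRHS](@lebesgue01_setT R) -[leRHS]mul1e -integral_cst//.
  apply: le_integral_lebesgue01 => //.
  - exact/measurable_EFinP.
  - by move=> x; rewrite lee_fin powR_ge0.
  move=> x /andP[x0 x1]; rewrite lee_fin.
  have /andP[y0 y1] : 0 <= x `^ a^-1 <= 1.
    by apply: powR_itv01; rewrite ?x1 ?invr_ge0 !ltW.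
  suff /andP[] : 0 <= H x <= 1 by [].
  apply: powR_itv01; first exact: ltW.
  by rewrite normr_ge0 ger0_norm ?subr_ge0// lerBlDr lerDl.
rewrite -/(H _) HB EFinM; congr (_ * _)%E.
have IB : (\int[mu]_x (B x)%:E \is a fin_num)%E.
  rewrite ge0_fin_numE; last by apply: integral_ge0 => x _; rewrite lee_fin.
  rewrite ltey; apply/eqP => IBy; move: H1.
  by rewrite HB IBy gt0_muley ?lte_fin// leye_eq.
rewrite /euler_beta /Rintegral addrK.
rewrite -(fineK IB); congr (fine _)%:E.
by rewrite ge0_integral_lebesgue01_cc//; exact/measurable_EFinP.
Qed.

Section operator.
Context (p q : R) (p1 : (1 <= p%:E)%E) (q1 : (1 <= q%:E)%E).
Local Notation T := (power_op p1 q1).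

Lemma opnorm_le (L : {linear LfunType mu p1 -> LfunType mu q1}) (C : \bar R) :
  (forall f : LfunType mu p1, ('N[mu]_p%:E[EFin \o f] <= 1)%E ->
     ('N[mu]_q%:E[EFin \o L f] <= C)%E) ->
  (opnorm L <= C)%E.
Proof. by move=> h; apply: ge_ereal_sup => _ [f /= f1 <-]; exact: h. Qed.

Lemma le_opnorm (L : {linear LfunType mu p1 -> LfunType mu q1})
    (f : LfunType mu p1) : ('N[mu]_p%:E[EFin \o f] <= 1)%E ->
  ('N[mu]_q%:E[EFin \o L f] <= opnorm L)%E.
Proof. by move=> f1; apply: ereal_sup_ubound; exists f. Qed.

Lemma power_opE a f x : T a f x = power_integral a f x.
Proof. by []. Qed.

Lemma power_opBE a b f x :
  (T a \- T b) f x = power_integral a f x - power_integral b f x.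
Proof. by []. Qed.

Lemma measurable_Lfun (r : R) (r1 : (1 <= r%:E)%E) (f : LfunType mu r1) :
  measurable_fun setT f.
Proof. exact: measurable_funP. Qed.

Lemma Lfun_integrableS (f : LfunType mu p1) (A : set R) : measurable A ->
  mu.-integrable A (EFin \o f).
Proof.
by move=> mA; have := Lfun01_integrable f; apply: integrableS.
Qed.

Context (p' : R) (pgt1 : 1 < p) (qgt1 : 1 < q) (pp' : p^-1 + p'^-1 = 1).
Let p0 : 0 < p. Proof. exact: lt_trans pgt1. Qed.
Let q0 : 0 < q. Proof. exact: lt_trans qgt1. Qed.
Let p'0 : 0 < p'. Proof. exact: conj_exponent_gt0 pp'. Qed.

Lemma normr_Rintegral_le (f : LfunType mu p1) (A : set R) (r : R) :
  measurable A -> mu A = r%:E -> ('N[mu]_p%:E[EFin \o f] <= 1)%E ->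
  `|\int[mu]_(y in A) f y| <= r `^ p'^-1.
Proof.
move=> mA Ar f1; have intf := Lfun_integrableS f mA.
apply: (le_trans (le_normr_Rintegral _ intf)); first exact: mA.
rewrite -lee_fin fineK; last first.
  by apply: integrable_fin_num => //; exact: integrable_norm.
apply: (le_trans (hoelder_indic mu p0 p'0 pp' (measurable_Lfun f) mA)).
rewrite -poweR_EFin -Ar -[leRHS]mul1e; apply: lee_wpmul2r => //.
exact: poweR_ge0.
Qed.

(** For f in the unit ball, Hoelder's inequality on [0, x ^ a] bounds the value
    at x by x ^ (a/p'), a function whose L^q norm is explicit. *)
Lemma opnorm_power_op_le a : 0 < a ->
  (opnorm (T a) <= ((a * (q / p') + 1) `^ (- q^-1))%:E)%E.
Proof.
move=> a0; apply: opnorm_le => f f1.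
have s0 : 0 < q / p' by rewrite divr_gt0.
apply: (@le_trans _ _
   ((\int[mu]_x (((x `^ a) `^ p'^-1) `^ q)%:E) `^ q^-1)%E).
  apply: Lnorm_le_lebesgue01 => //.
  - exact: measurable_Lfun.
  - by apply: (measurableT_comp (measurable_powR _)); exact: measurable_powR.
  - by move=> x; exact: powR_ge0.
  move=> x /andP[x0 x1]; rewrite power_opE.
  apply: normr_Rintegral_le => //; apply: lebesgue01_itv0.
  by apply: powR_itv01; rewrite ?x1 !ltW.
under eq_integral do rewrite -!powRrM.
rewrite integral_power; last first.
  by rewrite (lt_trans (_ : -1 < 0)) ?ltrN10// !mulr_gt0// invr_gt0.
rewrite poweR_EFin lee_fin.
rewrite [p'^-1 * q]mulrC.
have c0 : 0 <= a * (q / p') + 1 by rewrite addr_ge0// mulr_ge0// ltW.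
by rewrite -(powR_inv1 c0) -powRrM mulN1r.
Qed.

(** From 1 - x ^ a <= - a ln x and - e ln x = ln (x ^ (- e)) <= x ^ (- e). *)
Lemma onem_powR_le a e x : 0 < a -> 0 < e -> 0 < x ->
  1 - x `^ a <= a / e * x `^ (- e).
Proof.
move=> a0 e0 x0.
have h1 : 1 + a * ln x <= x `^ a by rewrite /powR gt_eqF// expR_ge1Dx.
have h2 : - e * ln x <= x `^ (- e).
  by rewrite -ln_powR ltW// ln_sublinear// powR_gt0.
apply: (@le_trans _ _ (a / e * (- e * ln x))); last first.
  by rewrite ler_wpM2l// divr_ge0// ltW.
rewrite mulrA mulrN divfK ?gt_eqF// mulNr.
lra.
Qed.

(** The values of the difference are integrals over ]x ^ a, 1], hence at most
    (1 - x ^ a) ^ (1/p') by Hoelder's inequality. *)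
Lemma opnorm_power_opB_le a : 0 < a ->
  (opnorm (T a \- T 0)%R <=
   (a `^ p'^-1 * ((2 * (q / p')) `^ p'^-1 * 2 `^ q^-1))%:E)%E.
Proof.
move=> a0; apply: opnorm_le => f f1.
pose s := q / p'; have s0 : 0 < s by rewrite divr_gt0.
(* With this exponent the q-th power of the bound is a multiple of x ^ (-1/2). *)
pose e := (2 * s)^-1; have e0 : 0 < e by rewrite invr_gt0 mulr_gt0.
pose c := a / e; have c0 : 0 <= c by rewrite divr_ge0// ltW.
apply: (@le_trans _ _
   ((\int[mu]_x (((c * x `^ (- e)) `^ p'^-1) `^ q)%:E) `^ q^-1)%E).
  apply: Lnorm_le_lebesgue01 => //.
  - exact: measurable_Lfun.
  - apply: (measurableT_comp (measurable_powR _)).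
    by apply: measurable_funM => //; exact: measurable_powR.
  - by move=> x; exact: powR_ge0.
  move=> x /andP[x0 x1]; rewrite power_opBE /power_integral powRr0.
  have /andP[xa0 xa1] : 0 <= x `^ a <= 1 by apply: powR_itv01; rewrite ?x1 !ltW.
  rewrite (_ : `[0, 1]%classic = `[0, x `^ a] `|` `]x `^ a, 1]); last first.
    by rewrite -itv_bndbnd_setU// bnd_simp.
  rewrite Rintegral_setU//; last 2 first.
  - by apply: Lfun_integrableS; exact: measurableU.
  - apply/disj_setPS => y [] /=; rewrite !in_itv/= => /andP[_ yt] /andP[ty _].
    by move: (le_lt_trans yt ty); rewrite ltxx.
  rewrite opprD addrA subrr sub0r normrN.
  apply: (@le_trans _ _ ((1 - x `^ a) `^ p'^-1)).
    apply: normr_Rintegral_le => //; apply: lebesgue01_itv1.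
    by rewrite xa0.
  apply: ge0_ler_powR; rewrite ?nnegrE ?invr_ge0 ?subr_ge0//.
  - exact: ltW.
  - by rewrite mulr_ge0// powR_ge0.
  - exact: onem_powR_le.
under eq_integral => x _.
  rewrite -powRrM powRM ?powR_ge0// -powRrM.
  rewrite (_ : - e * (p'^-1 * q) = - 2^-1); last first.
    rewrite [p'^-1 * q]mulrC -/s /e invfM mulNr -mulrA mulVf ?mulr1//.
    by rewrite gt_eqF.
  rewrite EFinM; over.
rewrite ge0_integralZl//=; last 3 first.
- by apply/measurable_EFinP; exact: measurable_powR.
- by move=> x _; rewrite lee_fin powR_ge0.
- by rewrite lee_fin powR_ge0.
rewrite integral_power; last by lra.
rewrite (_ : (- 2^-1 + 1)^-1 = 2 :> R); last by field.
rewrite -EFinM poweR_EFin lee_fin [leLHS]powRM ?powR_ge0// -powRrM.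
rewrite mulfK ?gt_eqF// mulrA -powRM -/s; last by rewrite mulr_ge0// ltW.
  by rewrite /c /e invrK.
exact: ltW.
Qed.

(** The region 0 <= y <= x ^ a, whose sections in x are the domains of
    integration of the operator. *)
Let region a : set (measurableTypeR R * measurableTypeR R) :=
  [set z : R * R | 0 <= z.2 /\ z.2 <= z.1 `^ a].

Let measurable_region a : measurable (region a).
Proof.
rewrite (_ : region a = (snd @^-1` `[0, +oo[) `&`
    ((fun z : R * R => z.1 `^ a - z.2) @^-1` `[0, +oo[)); last first.
  apply/seteqP; split => z /=; rewrite /region /= !in_itv/= !andbT subr_ge0.
    by [].
  by [].
have mf : measurable_fun [set: measurableTypeR R * measurableTypeR R]
    (fun z => z.1 `^ a - z.2 : R).
  apply: measurable_funB; last exact: measurable_snd.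
  exact: (measurableT_comp (measurable_powR a) measurable_fst).
apply: measurableI.
  rewrite -[X in measurable X]setTI.
  exact: (@measurable_snd _ _ (measurableTypeR R) (measurableTypeR R)).
by rewrite -[X in measurable X]setTI; exact: mf.
Qed.

Let xsection_region a x : xsection (region a) x = `[0, x `^ a]%classic.
Proof.
by apply/seteqP; split => y; rewrite /xsection /region /= in_itv/= inE/=;
  [case=> -> ->|move=> /andP].
Qed.

Let ysection_region a y : 0 < a -> 0 < y <= 1 ->
  mu (ysection (region a) y) = (1 - y `^ a^-1)%:E.
Proof.
move=> a0 /andP[y0 y1].
have /andP[b0 b1] : 0 <= y `^ a^-1 <= 1.
  by apply: powR_itv01; rewrite ?y1 ?invr_ge0 !ltW.
rewrite -(@lebesgue01_itv1 _ true) ?b0// !lebesgue01E; congr lebesgue_measure.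
have E x : 0 <= x -> (y <= x `^ a) = (y `^ a^-1 <= x).
  move=> x0; apply/idP/idP => h.
    rewrite -(powRr1 x0) -(divff (lt0r_neq0 a0)) powRrM.
    by apply: ge0_ler_powR; rewrite ?nnegrE ?invr_ge0 ?powR_ge0// ltW.
  rewrite -(powRr1 (ltW y0)) -(mulVf (lt0r_neq0 a0)) powRrM.
  by apply: ge0_ler_powR; rewrite ?nnegrE ?powR_ge0// ltW.
apply/seteqP; split => x; rewrite /ysection /region /= !in_itv/= inE/=.
  by move=> [[_ h] /andP[x0 ->]]; rewrite x0 -E// h.
by move=> [/andP[h _] /andP[x0 ->]]; rewrite x0 E// h ltW.
Qed.

(** Minkowski's integral inequality for the region, followed by Hoelder's
    inequality between |f| and the q-th root of the measure of the sections. *)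
Lemma opnorm_power_op_le_beta a : 0 < a ->
  (opnorm (T a) <= ((a * euler_beta (p' / q + 1) a) `^ p'^-1)%:E)%E.
Proof.
move=> a0; apply: opnorm_le => f f1.
have mf := measurable_Lfun f.
(* The Minkowski inequality applies to |f|; its membership in L^p provides the
   measurability of its integral over [0, x ^ a] as a function of x. *)
have absf : (fun x => `|f x|) \in Lfun mu p%:E.
  rewrite inE; apply/andP; split; rewrite inE/=; first exact: measurableT_comp.
  rewrite /finite_norm (_ : _ \o _ = abse \o (EFin \o f))// Lnorm_abse.
  exact: le_lt_trans f1 (ltry _).
pose g : LfunType mu p1 := Lfun_Sub p1 absf.
have gE x : g x = `|f x| by [].
have intg : mu.-integrable setT (EFin \o g) by exact: Lfun01_integrable.
have mg := measurable_Lfun g.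
pose w y := `|1 - y `^ a^-1| `^ q^-1.
have mw : measurable_fun setT w.
  apply: (measurableT_comp (measurable_powR _)); apply: measurableT_comp => //.
  by apply: measurable_funB => //; exact: measurable_powR.
have TgE x : (power_integral a g x)%:E =
    (\int[mu]_(y in xsection (region a) x) (g y)%:E)%E.
  rewrite xsection_region /power_integral /Rintegral fineK//.
  by apply: integrable_fin_num => //; exact: Lfun_integrableS.
apply: (@le_trans _ _ ((\int[mu]_x
    (\int[mu]_(y in xsection (region a) x) (g y)%:E) `^ q) `^ q^-1)%E).
  under eq_integral do rewrite -TgE poweR_EFin.
  apply: Lnorm_le_lebesgue01 => //.
  - exact: measurable_Lfun.
  - exact: (measurable_Lfun (T a g)).
  - by move=> x; apply: Rintegral_ge0 => y _; rewrite gE.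
  - move=> x _; rewrite power_opE.
    exact: (le_normr_Rintegral _ (Lfun_integrableS f (measurable_itv _))).
have g0 y : 0 <= g y by rewrite gE.
have M := minkowski_integral_section mu qgt1 (measurable_region a) g0 intg.
apply: (le_trans M).
apply: (@le_trans _ _ (\int[mu]_y `|(g y * w y)%:E|)%E).
  apply: le_integral_lebesgue01.
  - apply: emeasurable_funM; first exact/measurable_EFinP.
    apply: (measurableT_comp (measurable_poweR _)).
    by apply: measurable_fun_ysection; exact: measurable_region.
  - by move=> y; rewrite mule_ge0 ?poweR_ge0// lee_fin.
  - by apply: measurableT_comp => //; exact/measurable_EFinP/measurable_funM.
  - by move=> y; exact: abse_ge0.
  move=> y /[dup] y01 /andP[y0 y1].
  have /andP[z0 z1] : 0 <= y `^ a^-1 <= 1.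
    by apply: powR_itv01; rewrite ?y1 ?invr_ge0 !ltW.
  rewrite -[X in (_ * X `^ _)%E]/(mu (ysection (region a) y)) ysection_region//.
  rewrite poweR_EFin -EFinM abse_EFin lee_fin /w.
  by rewrite [X in _ <= `|_ * X `^ _|]ger0_norm ?subr_ge0// ler_norm.
have := hoelder mu mg mw p0 p'0 pp'; rewrite Lnorm1 => /le_trans; apply.
apply: (@le_trans _ _ (1 * 'N[mu]_p'%:E[EFin \o w])%E).
  apply: lee_wpmul2r; first exact: Lnorm_ge0.
  by rewrite (_ : EFin \o g = abse \o (EFin \o f))// Lnorm_abse.
rewrite mul1e Lnorm.unlock -poweR_EFin -integral_onem_powR_beta ?divr_gt0//.
rewrite le_eqVlt; apply/orP; left; apply/eqP; congr (_ `^ _)%E.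
apply: eq_integral => y _ /=.
by rewrite ger0_norm ?powR_ge0// -powRrM mulrC.
Qed.

End operator.
End upper_bounds.

(** * Lower bounds on operator norms *)

Section lower_bounds.
Context {R : realType}.
Local Notation mu := (@lebesgue01 R).
Implicit Types (p q a x y : R).

Lemma ge_Lnorm_lebesgue01 q (g k : R -> R) : 0 < q ->
  measurable_fun setT g -> measurable_fun setT k -> (forall x, 0 <= k x) ->
  (forall x, 0 < x <= 1 -> k x <= `|g x|) ->
  ((\int[mu]_x (k x `^ q)%:E) `^ q^-1 <= 'N[mu]_q%:E[EFin \o g])%E.
Proof.
move=> q0 mg mk k0 gk; rewrite Lnorm.unlock.
apply: ge0_le_poweR; first by rewrite invr_ge0 ltW.
  by apply: integral_ge0 => x _; rewrite lee_fin powR_ge0.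
apply: le_integral_lebesgue01.
- apply/measurable_EFinP.
  exact: (@measurableT_comp _ _ _ _ _ _ (@powR R ^~ q)).
- by move=> x; rewrite lee_fin powR_ge0.
- apply/measurable_EFinP.
  apply: (@measurableT_comp _ _ _ _ _ _ (@powR R ^~ q)) => //.
  exact: measurableT_comp.
- by move=> x; exact: poweR_ge0.
- move=> x x01; rewrite lee_fin ge0_ler_powR ?nnegrE//; first exact: ltW.
  exact: gk.
Qed.

Lemma Rintegral_cst_indic (c : R) (A D : set R) : measurable A -> measurable D ->
  \int[mu]_(y in D) (c * \1_A y) = c * fine (mu (A `&` D)).
Proof.
move=> mA mD; rewrite RintegralZl//; last first.
  by apply: (integrableS measurableT) => //; exact: integrable_indic.
by rewrite /Rintegral integral_indic.
Qed.

Section operator.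
Context (p q : R) (p1 : (1 <= p%:E)%E) (q1 : (1 <= q%:E)%E).
Local Notation T := (power_op p1 q1).
Context (p' : R) (pgt1 : 1 < p) (qgt1 : 1 < q) (pp' : p^-1 + p'^-1 = 1).
Let p0 : 0 < p. Proof. exact: lt_trans pgt1. Qed.
Let q0 : 0 < q. Proof. exact: lt_trans qgt1. Qed.
Let p'0 : 0 < p'. Proof. exact: conj_exponent_gt0 pp'. Qed.

(** Tested on the constant function 1. *)
Lemma le_opnorm_power_op a : 0 < a ->
  (((a * q + 1) `^ (- q^-1))%:E <= opnorm (T a))%E.
Proof.
move=> a0; pose f : LfunType mu p1 := Lfun_Sub p1 (Lfun_cst mu 1 p).
have f1 : ('N[mu]_p%:E[EFin \o f] <= 1)%E.
  rewrite (_ : EFin \o f = cst 1%E)// Lnorm_cst1.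
  by rewrite -[X in (X `^ _)%E]/(mu setT) lebesgue01_setT poweR1r.
apply: le_trans (le_opnorm (T a) f1).
have aq0 : 0 < a * q by rewrite mulr_gt0.
apply: (@le_trans _ _ ((\int[mu]_x ((x `^ a) `^ q)%:E) `^ q^-1)%E).
  under eq_integral do rewrite -powRrM.
  rewrite integral_power; last by rewrite (lt_trans _ aq0)// ltrN10.
  rewrite poweR_EFin lee_fin.
  have c0 : 0 <= a * q + 1 by rewrite addr_ge0// ltW.
  by rewrite -(powR_inv1 c0) -powRrM mulN1r.
apply: ge_Lnorm_lebesgue01 => //.
- exact: (measurable_Lfun (T a f)).
- by move=> x; exact: powR_ge0.
move=> x /andP[x0 x1]; rewrite power_opE /power_integral.
have h : 0 <= x `^ a <= 1 by apply: powR_itv01; rewrite ?x1 !ltW.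
rewrite (_ : \int[mu]_(y in _) _ = x `^ a) ?ler_norm//.
rewrite -[LHS]/(\int[mu]_(y in `[0, x `^ a]) 1) Rintegral_cst//= mul1r.
by rewrite -[X in fine X]/(mu `[0, x `^ a]%classic) lebesgue01_itv0.
Qed.

(** Tested on the normalized indicator of ]1 - a, 1]: for x <= e^-2 one has
    x ^ a <= e^(-2a) <= 1 - a, so that the whole mass of the test function, namely
    a ^ (1/p'), is lost by the operator of exponent a and kept by the one of
    exponent 0. *)
Lemma le_opnorm_power_opB a : 0 < a <= 2^-1 ->
  ((a `^ p'^-1 * expR (- 2) `^ q^-1)%:E <= opnorm (T a \- T 0)%R)%E.
Proof.
move=> /andP[a0 a12]; pose A := `]1 - a, 1]%classic.
have mA : measurable (A : set (measurableTypeR R)) by exact: measurable_itv.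
have muA : mu A = a%:E by rewrite lebesgue01_itv1 ?subKr//; apply/andP; split; lra.
pose c := a `^ (- p^-1).
pose F := fun y : R => c * \1_A y.
have mF : measurable_fun [set: measurableTypeR R] F.
  by apply: measurable_funM => //; exact: measurable_indic.
have NF : ('N[mu]_p%:E[EFin \o F] = 1)%E.
  rewrite Lnorm.unlock (_ : (\int[_]_x _)%E = 1%E) ?poweR1r//.
  under eq_integral => y _.
    rewrite /= (_ : (_ `^ _)%R = c `^ p * \1_A y); last first.
      rewrite /F ger0_norm ?mulr_ge0 ?powR_ge0// indicE.
      by case: (y \in A); rewrite ?mulr1// !mulr0 powR0// gt_eqF.
    rewrite EFinM; over.
  rewrite ge0_integralZl//; last 2 first.
  - exact/measurable_EFinP/measurable_indic.
  - by rewrite lee_fin powR_ge0.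
  rewrite integral_indic// setIT -[X in (_ * X)%E]/(mu A) muA -EFinM.
  rewrite /c -powRrM mulNr mulVf ?gt_eqF// powR_inv1 ?ltW// mulVf//.
  by rewrite gt_eqF.
have LF : F \in Lfun mu p%:E.
  rewrite inE; apply/andP; split; rewrite inE//=.
  by rewrite /finite_norm NF ltry.
pose f : LfunType mu p1 := Lfun_Sub p1 LF.
have f1 : ('N[mu]_p%:E[EFin \o f] <= 1)%E by rewrite (_ : EFin \o f = EFin \o F)// NF.
apply: le_trans (le_opnorm (T a \- T 0) f1).
pose B := `[0, expR (- 2)]%classic : set R.
have e20 : 0 <= expR (- 2 : R) <= 1.
  by rewrite expR_ge0/= expR_le1; lra.
have mB : measurable (B : set (measurableTypeR R)) by exact: measurable_itv.
pose k x := a `^ p'^-1 * \1_B x.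
apply: (@le_trans _ _ ((\int[mu]_x (k x `^ q)%:E) `^ q^-1)%E).
  under eq_integral => x _.
    rewrite (_ : k x `^ q = (a `^ p'^-1) `^ q * \1_B x); last first.
      rewrite /k indicE.
      by case: (x \in B); rewrite ?mulr1// !mulr0 powR0// gt_eqF.
    rewrite EFinM; over.
  rewrite ge0_integralZl//; last 2 first.
  - exact/measurable_EFinP/measurable_indic.
  - by rewrite lee_fin powR_ge0.
  rewrite integral_indic// setIT -[X in (_ * X)%E]/(mu B) lebesgue01_itv0//.
  rewrite -EFinM poweR_EFin lee_fin powRM ?powR_ge0 ?expR_ge0// -[X in _ <= X * _]powRrM.
  by rewrite divff ?gt_eqF// powRr1// powR_ge0.
apply: ge_Lnorm_lebesgue01 => //.
- exact: (measurable_Lfun ((T a \- T 0) f)).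
- by apply: measurable_funM => //; exact: measurable_indic.
- by move=> x; rewrite mulr_ge0 ?powR_ge0.
move=> x /andP[x0 x1]; rewrite /k indicE.
have [/set_mem xB|_] := boolP (x \in B); last by rewrite mulr0.
rewrite mulr1 power_opBE /power_integral powRr0.
rewrite -[X in X - _]/(\int[mu]_(y in _) (c * \1_A y)).
rewrite -[X in _ - X]/(\int[mu]_(y in _) (c * \1_A y)).
rewrite !Rintegral_cst_indic//.
have xa : x `^ a <= 1 - a.
  apply: (@le_trans _ _ (expR (- 2 * a))).
    rewrite expRM; apply: ge0_ler_powR; rewrite ?nnegrE ?expR_ge0 ?(ltW x0) ?(ltW a0)//.
    by move: xB; rewrite /B /= in_itv/= => /andP[].
  rewrite mulNr expRN.
  apply: (@le_trans _ _ (1 + 2 * a)^-1).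
    by rewrite lef_pV2 ?posrE ?expR_gt0 ?expR_ge1Dx//; lra.
  rewrite -div1r ler_pdivrMr; last by lra.
  by nra.
rewrite (_ : A `&` `[0, x `^ a] = set0); last first.
  apply/seteqP; split => // y [] /=; rewrite !in_itv/= => /andP[ay _] /andP[_ yx].
  by move: (lt_le_trans ay (le_trans yx xa)); rewrite ltxx.
rewrite (_ : A `&` `[0, 1] = A); last first.
  apply/setIidPl => y; rewrite /A /= !in_itv/= => /andP[ay y1].
  by apply/andP; split; lra.
have ca : c * a = a `^ p'^-1.
  rewrite (_ : p'^-1 = - p^-1 + 1); last by rewrite -pp' addKr.
  by rewrite powRD ?(gt_eqF a0) ?implybT// powRr1// ltW.
by rewrite measure0 mulr0 sub0r normrN muA /= ca ler_norm.
Qed.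

End operator.
End lower_bounds.

(** * Asymptotics *)

Section asymptotics.
Context {R : realType}.
Implicit Types (p q a t x : R) (f g : R -> R).

Lemma asymp_of_bounds (F : set_system R) {FF : Filter F} f g (c C : R) : 0 < c ->
  (\forall x \near F, 0 < g x /\ c * g x <= f x <= C * g x) -> asymp F f g.
Proof.
move=> c0 h; have fg x : 0 < g x -> c * g x <= f x -> 0 < f x.
  by move=> g0; apply: lt_le_trans; exact: mulr_gt0.
split.
- apply: filterS h => x [g0 /andP[h1 _]].
  by rewrite (gt_eqF g0) (gt_eqF (fg _ g0 h1)).
- rewrite /bounded_near; near=> M; apply: filterS h => x [g0 /andP[h1 h2]] /=.
  rewrite ger0_norm; last by rewrite divr_ge0// ltW//; exact: fg.
  rewrite ler_pdivrMr//; apply: le_trans h2 _.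
  by rewrite ler_wpM2r// ?(ltW g0).
- rewrite /bounded_near; near=> M; apply: filterS h => x [g0 /andP[h1 h2]] /=.
  have f0 := fg _ g0 h1.
  rewrite ger0_norm; last by rewrite divr_ge0// ltW.
  apply: (@le_trans _ _ c^-1) => //.
  by rewrite ler_pdivrMr// ler_pdivlMl.
Unshelve. all: by end_near. Qed.

Lemma powRN_antitone (r : R) x t : 0 <= r -> 0 < x -> x <= t ->
  t `^ (- r) <= x `^ (- r).
Proof.
move=> r0 x0 xt; rewrite !powRN lef_pV2 ?posrE ?powR_gt0//; last exact: lt_le_trans xt.
by apply: ge0_ler_powR; rewrite ?nnegrE ?(ltW x0) ?(ltW (lt_le_trans x0 xt)).
Qed.

(** Since a q + 1 <= exp (a q), the right-hand side is at least exp (- a). *)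
Lemma onem_le_powRN a q : 0 < a -> 0 < q -> 1 - a <= (a * q + 1) `^ (- q^-1).
Proof.
move=> a0 q0; apply: (@le_trans _ _ (expR (- a))); first exact: expR_ge1Dx.
have -> : expR (- a) = (expR (a * q)) `^ (- q^-1).
  by rewrite -expRM mulrN mulfK ?gt_eqF.
apply: powRN_antitone; first by rewrite invr_ge0 ltW.
  by rewrite addr_gt0// mulr_gt0.
by rewrite addrC expR_ge1Dx.
Qed.

(** Indeed - ln (1 + t) = ln (1 - t / (1 + t)) <= - t / (1 + t), and 1 + t <= 2. *)
Lemma half_le_ln1D t : 0 < t <= 1 -> t / 2 <= ln (1 + t).
Proof.
move=> /andP[t0 t1]; have t10 : 0 < 1 + t by lra.
apply: (@le_trans _ _ (t / (1 + t))).
  by rewrite ler_pM2l// lef_pV2 ?posrE//; lra.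
have h := @le_ln1Dx R (- (t / (1 + t))).
have E : 1 - t / (1 + t) = (1 + t)^-1 by field; lra.
move: h; rewrite E lnV ?posrE// => /(_ _); rewrite lerN2; apply.
rewrite ltrN2 ltr_pdivrMr//; lra.
Qed.

(** With u = a s / (2 q), the left-hand side is at most exp (- u) by the previous
    lemma, exp (- u) is at most 1 / (1 + u), and the latter is at most 1 - u / 2 as
    u <= 1. *)
Lemma powRN_le_onem s q a : 0 < q -> 0 < s -> 0 < a -> a * s <= 1 ->
  a * s / (2 * q) <= 1 -> (a * s + 1) `^ (- q^-1) <= 1 - a * s / (4 * q).
Proof.
move=> q0 s0 a0 as1 u1; set u := a * s / (2 * q) in u1 *.
have as0 : 0 < a * s by rewrite mulr_gt0.
have u0 : 0 < u by rewrite divr_gt0// mulr_gt0.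
apply: (@le_trans _ _ (expR (- u))).
  rewrite /powR gt_eqF; last by rewrite addr_gt0.
  rewrite ler_expR mulNr lerN2 addrC.
  have -> : u = q^-1 * (a * s / 2) by rewrite /u; field; lra.
  rewrite ler_pM2l ?invr_gt0//; apply: half_le_ln1D.
  by rewrite as0.
apply: (@le_trans _ _ (1 + u)^-1).
  by rewrite expRN lef_pV2 ?posrE ?expR_gt0 ?expR_ge1Dx//; lra.
have -> : a * s / (4 * q) = u / 2 by rewrite /u; field; lra.
rewrite -div1r ler_pdivrMr; last by lra.
nra.
Qed.

End asymptotics.

Theorem theorem2 (R : realType) (p q p' : R) (p1 : 1 < p) (q1 : 1 < q)
    (pp' : p^-1 + p'^-1 = 1) :
  let T := power_op (exponent_ge1 p1) (exponent_ge1 q1) in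
  [/\ forall alpha : R, 0 < alpha ->
        (((alpha * q + 1) `^ (- q^-1))%:E <= opnorm (T alpha) <=
         (Num.min ((alpha * (q / p') + 1) `^ (- q^-1))
                  ((alpha * euler_beta (p' / q + 1) alpha) `^ p'^-1))%:E)%E,
      asymp +oo_R (fun alpha => fine (opnorm (T alpha)))
                  (fun alpha => alpha `^ (- q^-1)),
      asymp 0^'+ (fun alpha => fine (opnorm (T alpha \- T 0)))
                 (fun alpha => alpha `^ p'^-1) &
      asymp 0^'+ (fun alpha => `|fine (opnorm (T alpha)) - 1|) id].
Proof.
have p0 : 0 < p by exact: lt_trans p1.
have q0 : 0 < q by exact: lt_trans q1.
have p'0 : 0 < p' by exact: conj_exponent_gt0 pp'.
have qp'0 : 0 < q / p' by rewrite divr_gt0.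
move=> T.
have fine_bounds (X : \bar R) (b c : R) : (b%:E <= X)%E -> (X <= c%:E)%E ->
    b <= fine X <= c.
  by case: X => [x||]//; rewrite !lee_fin => -> ->.
have TB a : 0 < a ->
    (a * q + 1) `^ (- q^-1) <= fine (opnorm (T a)) <= (a * (q / p') + 1) `^ (- q^-1).
  move=> a0; apply: fine_bounds; first exact: le_opnorm_power_op.
  exact: opnorm_power_op_le.
have qN : 0 <= q^-1 by rewrite invr_ge0 ltW.
split.
- move=> a a0; rewrite le_opnorm_power_op//=.
  rewrite EFin_min le_min.
  by rewrite (opnorm_power_op_le _ _ p1 q1 pp')// opnorm_power_op_le_beta.
- apply: (@asymp_of_bounds _ _ _ _ _ ((q + 1) `^ (- q^-1)) ((q / p') `^ (- q^-1))).
    by rewrite powR_gt0// addr_gt0.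
  near=> a; have a1 : 1 <= a by near: a; exact: nbhs_pinfty_ge.
  have a0 : 0 < a by exact: lt_le_trans a1.
  split; first exact: powR_gt0.
  have /andP[h1 h2] := TB a a0; apply/andP; split.
    (* a q + 1 <= (q + 1) a because a >= 1 *)
    apply: le_trans h1; rewrite -powRM ?(ltW a0)//; last by rewrite addr_ge0// ltW.
    apply: powRN_antitone => //; first by rewrite addr_gt0// mulr_gt0.
    by rewrite mulrDl mul1r [q * a]mulrC lerD2l.
  apply: (le_trans h2); rewrite -powRM ?(ltW a0) ?(ltW qp'0)//.
  apply: powRN_antitone => //; first by rewrite mulr_gt0.
  by rewrite mulrC lerDl.
- apply: (@asymp_of_bounds _ _ _ _ _ (expR (- 2) `^ q^-1)
     ((2 * (q / p')) `^ p'^-1 * 2 `^ q^-1)).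
    by rewrite powR_gt0// expR_gt0.
  near=> a; have a0 : 0 < a by near: a; exact: nbhs_right_gt.
  have a12 : a <= 2^-1 by near: a; apply: nbhs_right_le; rewrite invr_gt0.
  split; first exact: powR_gt0.
  rewrite ![_ * a `^ _]mulrC; apply: fine_bounds.
    by apply: le_opnorm_power_opB => //; rewrite a0.
  exact: opnorm_power_opB_le.
- apply: (@asymp_of_bounds _ _ _ _ _ ((4 * p')^-1) 1).
    by rewrite invr_gt0 mulr_gt0.
  near=> a; have a0 : 0 < a by near: a; exact: nbhs_right_gt.
  have as1 : a * (q / p') <= 1.
    rewrite -ler_pdivlMr//; near: a; apply: nbhs_right_le.
    by rewrite divr_gt0.
  have ap' : a <= 2 * p' by near: a; apply: nbhs_right_le; rewrite mulr_gt0.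
  split=> //=.
  have /andP[h1 h2] := TB a a0.
  have l1 := onem_le_powRN a0 q0.
  have u1 : a * (q / p') / (2 * q) <= 1.
    rewrite (_ : _ / _ = a / (2 * p')); last by field; lra.
    by rewrite ler_pdivrMr ?mul1r// mulr_gt0.
  have := powRN_le_onem q0 qp'0 a0 as1 u1.
  rewrite (_ : a * (q / p') / (4 * q) = (4 * p')^-1 * a); last by field; lra.
  have d0 : 0 < (4 * p')^-1 * a by rewrite mulr_gt0// invr_gt0 mulr_gt0.
  move=> h3; rewrite distrC ger0_norm; last by lra.
  by apply/andP; split; lra.
Unshelve. all: by end_near. Qed.
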